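(* Let $f:\mathbb{R}^d\to\mathbb{R}$ be $(\mu,\tau)$-restricted strongly convex and $(L,\tau)$-restricted smooth on $\mathbb{R}^d$. Let $s\ge s^*>0$ be integers, $\bar L=L+3\tau s$, $\bar\mu=\mu-3\tau s$, $\bar\kappa=\bar L/\bar\mu$, and assume $\bar\mu>0$ and $s\ge(240\bar\kappa)^2s^*$. Let $\widehat f\ge\min_{\|\theta\|_0\le s^*}f(\theta)$ and let $\widehat\theta$ be any $s^*$-sparse vector with $f(\widehat\theta)=\widehat f$. Let $\{\theta_t\}$ be the iterates generated by Sparse Polyak IHT (defined in the context) with function $f$, target value $\widehat f$ and sparsity parameter $s$, and let $t_0\ge0$ be the first iteration for which $\|\theta_{t_0}-\widehat\theta\|^2<\frac{36\|\mathrm{HT}_s(\nabla f(\widehat\theta))\|^2}{\bar\mu^2}$. Suppose further that the signal-to-noise ratio condition $$|\widehat\theta|_{\min}\ge\frac{7\|\mathrm{HT}_s(\nabla f(\widehat\theta))\|}{\bar\mu}$$ holds. Then for any $t\ge t_0$ the support of $\theta_t$ contains the support of $\widehat\theta$, and the sequence $(\|\theta_t-\widehat\theta\|^2)_{t\ge t_0}$ is non-increasing and upper bounded by $\frac{36\|\mathrm{HT}_s(\nabla f(\widehat\theta))\|^2}{\bar\mu^2}$.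
   Context: $\|\cdot\|$ is the Euclidean norm, $\|\cdot\|_1$ the $\ell_1$-norm, and $\|x\|_0=|\{i:x_i\ne0\}|$; $x$ is $k$-sparse if $\|x\|_0\le k$. The support of $x$ is $\{i:x_i\ne0\}$, and $|x|_{\min}$ is the minimum of $|x_i|$ over $i$ in the support of $x$. The function $f$ is differentiable, $\mu,L>0$, $\tau\ge0$. Restricted strong convexity $(\mu,\tau)$: for all $\theta_1,\theta_2\in\mathbb{R}^d$, $\frac{\mu}{2}\|\theta_1-\theta_2\|^2-\frac{\tau}{2}\|\theta_1-\theta_2\|_1^2\le f(\theta_1)-f(\theta_2)-\langle\nabla f(\theta_2),\theta_1-\theta_2\rangle$. Restricted smoothness $(L,\tau)$: for all $\theta_1,\theta_2\in\mathbb{R}^d$, $f(\theta_1)-f(\theta_2)-\langle\nabla f(\theta_2),\theta_1-\theta_2\rangle\le\frac{L}{2}\|\theta_1-\theta_2\|^2+\frac{\tau}{2}\|\theta_1-\theta_2\|_1^2$. Hard thresholding: $\mathrm{HT}_s(z)=\mathrm{argmin}_{\|\theta\|_0\le s}\|\theta-z\|$, ties broken lexicographically (it keeps the $s$ largest-magnitude entries of $z$ and sets the rest to zero). Sparse Polyak IHT (Algorithm 1 of the paper), with inputs $f$, target value $\widehat f$, sparsity parameter $s$: start from any $\theta_0\in\mathbb{R}^d$ with $\|\theta_0\|_0\le s$; for $t=0,1,2,\dots$ set $$\gamma_t=\frac{\max\{f(\theta_t)-\widehat f,0\}}{5\|\mathrm{HT}_s(\nabla f(\theta_t))\|^2},\qquad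 \theta_{t+1}=\mathrm{HT}_s(\theta_t-\gamma_t\nabla f(\theta_t)).$$ (If $\nabla f(\theta_t)=0$ the update gives $\theta_{t+1}=\theta_t$ whatever value is assigned to $\gamma_t$.) *)

(* Defs.v *)
From HB Require Import structures.
From mathcomp Require Import all_boot all_order all_algebra.
From mathcomp Require Import all_classical all_reals all_analysis.

Set Implicit Arguments.
Unset Strict Implicit.
Unset Printing Implicit Defensive.

Import Order.TTheory GRing.Theory Num.Theory.
Import numFieldNormedType.Exports.

Local Open Scope ring_scope.

(* The vectors of R^d are row vectors 'rV[R]_d.  The norm `|x| that the library
   puts on them is the sup norm, hence the explicit norms below; in finite
   dimension the choice of norm does not affect differentiability. *)

Definition dot (R : realType) (d : nat) (x y : 'rV[R]_d) : R :=
  \sum_i x ord0 i * y ord0 i.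

Definition norm2 (R : realType) (d : nat) (x : 'rV[R]_d) : R :=
  Num.sqrt (\sum_i x ord0 i ^+ 2).

Definition norm1 (R : realType) (d : nat) (x : 'rV[R]_d) : R :=
  \sum_i `|x ord0 i|.

Definition supp (R : realType) (d : nat) (x : 'rV[R]_d) : {set 'I_d} :=
  [set i | x ord0 i != 0]%SET.

Definition norm0 (R : realType) (d : nat) (x : 'rV[R]_d) : nat := #|supp x|.

Definition sparse (R : realType) (d k : nat) (x : 'rV[R]_d) : Prop :=
  (norm0 x <= k)%N.

(* Extended-real valued, so that the minimum over an empty support is +oo. *)
Definition abs_min (R : realType) (d : nat) (x : 'rV[R]_d) : \bar R :=
  \big[Order.min/+oo%E]_(i in supp x) (`|x ord0 i|)%:E.

Definition grad (R : realType) (d : nat) (f : 'rV[R]_d -> R) (x : 'rV[R]_d) :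
    'rV[R]_d :=
  \row_i 'D_(delta_mx ord0 i) f x.

Definition restricted_strongly_convex (R : realType) (d : nat)
    (f : 'rV[R]_d -> R) (mu tau : R) : Prop :=
  forall x y : 'rV[R]_d,
    mu / 2 * norm2 (x - y) ^+ 2 - tau / 2 * norm1 (x - y) ^+ 2
      <= f x - f y - dot (grad f y) (x - y).

Definition restricted_smooth (R : realType) (d : nat)
    (f : 'rV[R]_d -> R) (L tau : R) : Prop :=
  forall x y : 'rV[R]_d,
    f x - f y - dot (grad f y) (x - y)
      <= L / 2 * norm2 (x - y) ^+ 2 + tau / 2 * norm1 (x - y) ^+ 2.

Definition sparse_min (R : realType) (d : nat) (f : 'rV[R]_d -> R) (k : nat)
    (m : R) : Prop :=
  (exists2 x, sparse k x & f x = m) /\ (forall x, sparse k x -> m <= f x).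

Definition sparse_argmin_dist (R : realType) (d s : nat) (z u : 'rV[R]_d) :
    Prop :=
  sparse s u /\ (forall v, sparse s v -> norm2 (u - z) <= norm2 (v - z)).

(* Lexicographic tie-breaking: distinct nearest s-sparse vectors have distinct
   supports, and the selected one keeps the smaller index at the first
   coordinate where it differs from a competitor. *)
Definition is_hard_threshold (R : realType) (d s : nat) (z u : 'rV[R]_d) :
    Prop :=
  sparse_argmin_dist s z u /\
  (forall v, sparse_argmin_dist s z v -> v <> u ->
     exists i : 'I_d, [/\ u ord0 i != 0, v ord0 i = 0 &
       forall j : 'I_d, (j < i)%N -> u ord0 j = v ord0 j]).

(* The default value 0 of xget is never used: see hard_thresholdP. *)
Definition hard_threshold (R : realType) (d s : nat) (z : 'rV[R]_d) :
    'rV[R]_d :=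
  xget 0 (is_hard_threshold s z : set 'rV[R]_d).

(* Division by 0 yields 0, so the step size is 0 when the gradient vanishes. *)
Definition polyak_step (R : realType) (d : nat) (f : 'rV[R]_d -> R) (fhat : R)
    (s : nat) (x : 'rV[R]_d) : R :=
  Num.max (f x - fhat) 0 / (5 * norm2 (hard_threshold s (grad f x)) ^+ 2).

Definition sparse_polyak (R : realType) (d : nat) (f : 'rV[R]_d -> R) (fhat : R)
    (s : nat) (x0 : 'rV[R]_d) (t : nat) : 'rV[R]_d :=
  iter t (fun x => hard_threshold s (x - polyak_step f fhat s x *: grad f x)) x0.

Section HardThreshold.
Variables (R : realType) (d s : nat) (z : 'rV[R]_d).

Let restr (S : {set 'I_d}) : 'rV[R]_d :=
  \row_i (if i \in S then z ord0 i else 0).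
Let sqd (v : 'rV[R]_d) : R := \sum_i (v - z) ord0 i ^+ 2.

Let norm2_sqd u v : (norm2 (u - z) <= norm2 (v - z)) = (sqd u <= sqd v).
Proof. by rewrite ler_sqrt //; apply: sumr_ge0 => i _; exact: sqr_ge0. Qed.

Let supp_restr S : supp (restr S) \subset S.
Proof. by apply/fintype.subsetP => i; rewrite inE mxE; case: ifP => //; rewrite eqxx. Qed.

Let restr_coef v i :
  (restr (supp v) - z) ord0 i ^+ 2 <= (v - z) ord0 i ^+ 2.
Proof.
rewrite !mxE inE; case: eqP => [->|_] //=.
by rewrite subrr expr0n sqr_ge0.
Qed.

Let restr_sqd v : sqd (restr (supp v)) <= sqd v.
Proof. by apply: ler_sum => i _; exact: restr_coef. Qed.

Let sqd_restr_eq v : sqd v <= sqd (restr (supp v)) -> v = restr (supp v).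
Proof.
move=> le_v; apply/rowP => i; rewrite mxE inE.
have [->//|vi] /= := eqVneq (v ord0 i) 0.
have : \sum_k ((v - z) ord0 k ^+ 2 - (restr (supp v) - z) ord0 k ^+ 2) == 0.
  by rewrite sumrB subr_eq0 eq_le le_v restr_sqd.
rewrite psumr_eq0 => [|k _]; last by rewrite subr_ge0 restr_coef.
move=> /allP /(_ i (mem_index_enum _)) /=.
by rewrite !mxE inE vi subrr expr0n subr0 expf_eq0 /= subr_eq0 => /eqP.
Qed.

Lemma is_hard_threshold_exists : exists u, is_hard_threshold s z u.
Proof.
have P0 : (#|(finset.set0 : {set 'I_d})| <= s)%N by rewrite cards0.
pose S0 := [arg min_(S < finset.set0 | (#|S| <= s)%N) sqd (restr S)]%O.
have [S0s S0min] : (#|S0| <= s)%N /\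
    forall S : {set 'I_d}, (#|S| <= s)%N -> sqd (restr S0) <= sqd (restr S).
  by rewrite /S0; case: arg_minP => //.
have S0le v : sparse s v -> sqd (restr S0) <= sqd v.
  by move=> vs; apply: le_trans (restr_sqd v); apply: S0min.
pose P (S : {set 'I_d}) := (#|S| <= s)%N && (supp (restr S) == S)
                           && (sqd (restr S) <= sqd (restr S0)).
have argP v : sparse_argmin_dist s z v -> P (supp v) /\ v = restr (supp v).
  case=> vs vmin.
  have vS0 : sqd v <= sqd (restr S0).
    rewrite -norm2_sqd; apply: vmin.
    by apply: leq_trans S0s; apply: subset_leq_card.
  have ev : v = restr (supp v).
    by apply: sqd_restr_eq; apply: le_trans vS0 _; apply: S0min.
  by split=> //; rewrite /P -ev vS0 eqxx !andbT.
have Parg S : P S -> sparse_argmin_dist s z (restr S).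
  move=> /andP[/andP[Ss /eqP eS] leS]; split; first by rewrite /sparse /norm0 eS.
  by move=> v vs; rewrite norm2_sqd; apply: le_trans leS (S0le v vs).
have S0arg : sparse_argmin_dist s z (restr S0).
  split; last by move=> v vs; rewrite norm2_sqd S0le.
  by apply: leq_trans S0s; apply: subset_leq_card.
have [PS0 _] := argP _ S0arg.
pose key (S : {set 'I_d}) : d.-tuplelexi bool := [tuple i \in S | i < d].
pose S1 := [arg max_(S > supp (restr S0) | P S) key S]%O.
have [PS1 S1max] : P S1 /\ forall S, P S -> (key S <= key S1)%O.
  by rewrite /S1; case: arg_maxP => //.
exists (restr S1); split; first exact: Parg.
move=> v /argP[Pv ev] vS1.
have sS1 : supp (restr S1) = S1 by move: PS1 => /andP[/andP[_ /eqP]].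
have : (key (supp v) < key S1)%O.
  rewrite lt_neqAle S1max // andbT; apply/eqP => ek; apply: vS1.
  rewrite ev; congr restr; apply/finset.setP => i.
  by move/(congr1 (fun t : d.-tuple bool => tnth t i)): ek; rewrite !tnth_mktuple.
move=> /ltxi_tuplePlt[i eqi]; rewrite !tnth_mktuple.
move=> lti; exists i.
have [iv iS] : i \notin supp v /\ i \in S1.
  by move: lti; case: (i \in supp v); case: (i \in S1).
split.
- by move: iS; rewrite -{1}sS1 inE.
- by move: iv; rewrite inE negbK => /eqP.
- move=> j ji; have := eqi j ji; rewrite !tnth_mktuple ev => ejS.
  have e2 : (supp (restr (supp v))) = supp v by rewrite -ev.
  by rewrite !mxE -ejS e2.
Qed.

Lemma is_hard_threshold_uniq u v :
  is_hard_threshold s z u -> is_hard_threshold s z v -> u = v.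
Proof.
move=> [au lu] [av lv]; have [//|/eqP uv] := eqVneq u v.
have [i [ui vi eqi]] := lu v av (fun e => uv (esym e)).
have [j [vj uj eqj]] := lv u au uv.
case: (ltngtP i j) => [ij|ji|/val_inj ij].
- by move: ui; rewrite -(eqj i ij) vi eqxx.
- by move: vj; rewrite -(eqi j ji) uj eqxx.
- by move: ui; rewrite ij uj eqxx.
Qed.

Lemma hard_thresholdP : is_hard_threshold s z (hard_threshold s z).
Proof. exact: xgetPex is_hard_threshold_exists. Qed.

End HardThreshold.

(* Main.v *)
Require Import Defs.
From mathcomp Require Import all_boot all_order all_algebra.
From mathcomp Require Import all_classical all_reals all_analysis.
From mathcomp Require Import ring lra.

Set Implicit Arguments.
Unset Strict Implicit.
Unset Printing Implicit Defensive.

Import Order.TTheory GRing.Theory Num.Theory.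
Import numFieldNormedType.Exports.
Local Open Scope ring_scope.

(** Write [e] for the distance of an iterate [x] to the target [y], and [E] for
    the distance of the next iterate [u = HT_s z], [z = x - gamma g], to [y].
    Expanding the square around [u] gives

      E^2 - 2 <z - u, y - u>
        = e^2 + 2 gamma <g, y - x> + (2 gamma <g, x - u> - |x - u|^2).

    The bracket lives on the union of two supports of size at most [s], so by
    completing squares it is at most [2 gamma^2 |HT_s g|^2], and the Polyak step
    is chosen so that this is dominated by [2 gamma (f x - f y)].  On sparse
    vectors restricted strong convexity implies the gradient inequality, so the
    middle term is at most [- 2 gamma (f x - f y)].  Hence the step would not
    increase the distance, were it not for the thresholding error
    [2 <z - u, y - u>] ([polyak_step_dist]).

    That error is controlled twice.  First, always, by [rho E^2] for any [rho]
    in (0, 1] with [sstar <= rho^2 s] ([hard_threshold_concavity]); here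
    [rho = 1/240] qualifies, so one step inflates the distance by a tiny factor
    at most.  An iterate in the ball of radius [6 |HT_s grad| / mubar] therefore
    moves to a point within [7 |HT_s grad| / mubar] of the target, and the
    signal-to-noise condition then forces its support to contain that of the
    target.  Second,
    once the support is known to contain that of the target, [z - u] and
    [y - u] have disjoint supports, so the thresholding error is exactly zero
    ([dot_hard_threshold_residual]) and the same estimate shows that the
    distance did not increase at all.  Thus the ball is invariant, and support
    containment and monotonicity hold from the hitting time onwards. *)

(** * Norms of sparse vectors *)

Lemma norm2_sqr (R : realType) (d : nat) (x : 'rV[R]_d) :
  norm2 x ^+ 2 = \sum_i x ord0 i ^+ 2.
Proof. by rewrite sqr_sqrtr //; apply: sumr_ge0 => i _; exact: sqr_ge0. Qed.

Lemma norm2_ge0 (R : realType) (d : nat) (x : 'rV[R]_d) : 0 <= norm2 x.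
Proof. exact: sqrtr_ge0. Qed.

Lemma coord_sqr_le_norm2 (R : realType) (d : nat) (x : 'rV[R]_d) (i : 'I_d) :
  x ord0 i ^+ 2 <= norm2 x ^+ 2.
Proof.
rewrite norm2_sqr (bigD1 i) //= lerDl.
by apply: sumr_ge0 => j _; exact: sqr_ge0.
Qed.

Lemma sum_mem_card (R : realType) (d : nat) (A : {set 'I_d}) (a : R) :
  \sum_(i in A) a = #|A|%:R * a.
Proof. by rewrite sumr_const mulr_natl. Qed.

(** Cauchy-Schwarz on the support, obtained by summing
    [2 |x_i| |x_j| <= x_i^2 + x_j^2] over all pairs. *)
Lemma norm1_sqr_le (R : realType) (d k : nat) (x : 'rV[R]_d) :
  sparse k x -> norm1 x ^+ 2 <= k%:R * norm2 x ^+ 2.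
Proof.
move=> xk; pose S := supp x.
have out i : i \notin S -> x ord0 i = 0 by rewrite inE negbK => /eqP.
have n1E : norm1 x = \sum_(i in S) `|x ord0 i|.
  rewrite /norm1 (bigID (mem S)) /= [X in _ + X]big1 ?addr0 // => i /out ->.
  by rewrite normr0.
apply: (@le_trans _ _ (#|S|%:R * norm2 x ^+ 2)); last first.
  by rewrite ler_wpM2r ?sqr_ge0 // ler_nat.
have n2E : \sum_(i in S) x ord0 i ^+ 2 <= norm2 x ^+ 2.
  rewrite norm2_sqr [leRHS](bigID (mem S)) /= lerDl.
  by apply: sumr_ge0 => i _; exact: sqr_ge0.
apply: le_trans (ler_wpM2l (ler0n _ _) n2E).
have sumE : 2 * (#|S|%:R * \sum_(i in S) x ord0 i ^+ 2)
    = \sum_(i in S) \sum_(j in S) (x ord0 i ^+ 2 + x ord0 j ^+ 2).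
  under [RHS]eq_bigr do rewrite big_split /= sum_mem_card.
  by rewrite big_split /= sum_mem_card -mulr_sumr mulr_natl mulr2n.
rewrite -(ler_pM2l (ltr0n R 2)) sumE n1E expr2 mulr_suml mulr_sumr.
apply: ler_sum => i _; rewrite mulrA mulr_sumr; apply: ler_sum => j _.
rewrite -[x ord0 i ^+ 2]real_normK ?num_real //.
rewrite -[x ord0 j ^+ 2]real_normK ?num_real //.
have := sqr_ge0 (`|x ord0 i| - `|x ord0 j|); nra.
Qed.

Lemma sparse_sub (R : realType) (d k l : nat) (x y : 'rV[R]_d) :
  sparse k x -> sparse l y -> sparse (k + l) (x - y).
Proof.
move=> xk yl; apply: leq_trans (leq_add xk yl).
apply: (@leq_trans #|supp x :|: supp y|).
  apply: subset_leq_card; apply/fintype.subsetP => i.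
  rewrite !inE !mxE; apply: contraNT.
  by rewrite negb_or !negbK => /andP[/eqP-> /eqP->]; rewrite subr0.
by rewrite cardsU leq_subr.
Qed.

(** The l1 penalty costs at most [tau * k] in the curvature along a [k]-sparse
    direction, so the restricted condition is ordinary convexity there. *)
Lemma sparse_gradient_ineq (R : realType) (d k : nat) (f : 'rV[R]_d -> R)
    (mu tau : R) (x y : 'rV[R]_d) :
  0 <= tau -> tau * k%:R <= mu -> restricted_strongly_convex f mu tau ->
  sparse k (x - y) -> dot (grad f y) (x - y) <= f x - f y.
Proof.
move=> tau0 tau_k rsc /norm1_sqr_le n1.
have := rsc x y; have := sqr_ge0 (norm2 (x - y)).
move: n1 tau_k tau0; set a := norm2 _ ^+ 2; set b := norm1 _ ^+ 2.
set m := k%:R => n1 tau_k tau0 a0.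
have : tau * b <= mu * a.
  apply: le_trans (ler_wpM2r a0 tau_k); rewrite -mulrA; exact: ler_wpM2l.
lra.
Qed.

(** Comparing the two restricted conditions along one nonzero sparse direction;
    this is what makes the restricted condition number at least 1, so that the
    lower bound on [s] yields a small thresholding error. *)
Lemma restricted_convexity_le_smoothness (R : realType) (d k : nat)
    (f : 'rV[R]_d -> R) (mu L tau : R) (v : 'rV[R]_d) :
  0 <= tau -> restricted_strongly_convex f mu tau -> restricted_smooth f L tau ->
  sparse k v -> norm2 v != 0 -> mu <= L + 2 * tau * k%:R.
Proof.
move=> tau0 rsc rs /norm1_sqr_le n1 v0.
have := le_trans (rsc v 0) (rs v 0); rewrite !subr0.
have : 0 < norm2 v ^+ 2 by rewrite exprn_even_gt0.
move: n1; set a := norm2 _ ^+ 2; set b := norm1 _ ^+ 2; set m := k%:R.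
move=> n1 a0 h; rewrite -(ler_pM2r a0).
have := ler_wpM2l tau0 n1; lra.
Qed.

(** * Hard thresholding *)

Section HardThresholding.
Variables (R : realType) (d s : nat) (z : 'rV[R]_d).
Let u := hard_threshold s z.
Let S := supp u.

Lemma hard_threshold_sparse : sparse s u.
Proof. by case: (hard_thresholdP s z) => -[]. Qed.

(* Optimality of [u] tested against the restriction of [z] to [T]. *)
Let hard_threshold_dist (T : {set 'I_d}) : (#|T| <= s)%N ->
  \sum_i (u ord0 i - z ord0 i) ^+ 2 <= \sum_(i | i \notin T) z ord0 i ^+ 2.
Proof.
move=> Ts; pose v : 'rV[R]_d := \row_i (if i \in T then z ord0 i else 0).
have vs : sparse s v.
  apply: leq_trans Ts; apply: subset_leq_card; apply/fintype.subsetP => i.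
  by rewrite inE mxE; case: ifP; rewrite ?eqxx.
have [[_ /(_ v vs) umin] _] := hard_thresholdP s z.
have := ler_pM (norm2_ge0 _) (norm2_ge0 _) umin umin.
rewrite -!expr2 !norm2_sqr (eq_bigr (fun i => (u ord0 i - z ord0 i) ^+ 2));
  last by move=> i _; rewrite !mxE.
move=> /le_trans -> //; rewrite (bigID (mem T)) /= big1 ?add0r.
  rewrite le_eqVlt; apply/orP; left; apply/eqP; apply: eq_bigr => i /negbTE iT.
  by rewrite !mxE iT sub0r sqrrN.
by move=> i iT; rewrite !mxE iT subrr expr0n.
Qed.

Lemma hard_threshold_out i : i \notin supp u -> u ord0 i = 0.
Proof. by rewrite inE negbK => /eqP. Qed.

Lemma hard_threshold_in i : i \in supp u -> u ord0 i = z ord0 i.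
Proof.
move=> iS; have := hard_threshold_dist hard_threshold_sparse.
rewrite (bigID (mem S)) /= [X in _ + X](eq_bigr (fun i => z ord0 i ^+ 2));
  last by move=> j /hard_threshold_out ->; rewrite sub0r sqrrN.
rewrite gerDr (bigD1 i) //= => le0; apply/eqP; rewrite -subr_eq0 -sqrf_eq0.
rewrite eq_le sqr_ge0 andbT; apply: le_trans le0; rewrite lerDl.
by apply: sumr_ge0 => j _; exact: sqr_ge0.
Qed.

Lemma hard_threshold_norm2 :
  norm2 u ^+ 2 = \sum_(i in supp u) z ord0 i ^+ 2.
Proof.
rewrite norm2_sqr (bigID (mem S)) /= [X in _ + X]big1 ?addr0.
  by apply: eq_bigr => i /hard_threshold_in ->.
by move=> i /hard_threshold_out ->; rewrite expr0n.
Qed.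

(** Among all sets of [s] coordinates, the selected one carries the most energy
    of [z]. *)
Lemma hard_threshold_mass (T : {set 'I_d}) : (#|T| <= s)%N ->
  \sum_(i in T) z ord0 i ^+ 2 <= norm2 u ^+ 2.
Proof.
move=> Ts; have := hard_threshold_dist Ts; rewrite hard_threshold_norm2.
rewrite (bigID (mem S)) /= big1 ?add0r => [|i /hard_threshold_in ->];
  last by rewrite subrr expr0n.
rewrite (eq_bigr (fun i => z ord0 i ^+ 2)) => [leST|i /hard_threshold_out ->];
  last by rewrite sub0r sqrrN.
have tot (A : {set 'I_d}) : \sum_i z ord0 i ^+ 2 =
    \sum_(i in A) z ord0 i ^+ 2 + \sum_(i | i \notin A) z ord0 i ^+ 2.
  by rewrite (bigID (mem A)).
by rewrite -(lerD2r (\sum_(i | i \notin T) z ord0 i ^+ 2)) -tot (tot S) lerD2l.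
Qed.

(** Otherwise exchanging [j] for [i] in the support would increase its energy. *)
Lemma hard_threshold_exchange i j : i \notin supp u -> j \in supp u ->
  z ord0 i ^+ 2 <= z ord0 j ^+ 2.
Proof.
move=> iS jS; have := @hard_threshold_mass (i |: S :\ j).
have iSj : i \notin S :\ j by rewrite inE (negbTE iS) andbF.
rewrite cardsU1 iSj.
have := hard_threshold_sparse; rewrite /sparse /norm0 (cardsD1 j) jS => us.
move=> /(_ us); rewrite hard_threshold_norm2 big_setU1 //= (big_setD1 j jS) /=.
by rewrite lerD2r.
Qed.

(** A free slot in the support would be used by any nonzero coordinate. *)
Lemma hard_threshold_unsaturated i :
  (#|supp u| < s)%N -> i \notin supp u -> z ord0 i = 0.
Proof.
move=> us iS; have := @hard_threshold_mass (i |: S).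
rewrite cardsU1 iS => /(_ us); rewrite hard_threshold_norm2 big_setU1 //=.
by rewrite gerDr => le0; apply/eqP; rewrite -sqrf_eq0 eq_le le0 sqr_ge0.
Qed.

(** The residual [z - u] vanishes on the support of [u], so the projection error
    comes only from coordinates of [y] that the thresholding missed. *)
Lemma dot_hard_threshold_residual (y : 'rV[R]_d) :
  dot (z - u) (y - u) =
  \sum_(i in supp y :\: supp u) z ord0 i * y ord0 i.
Proof.
rewrite /dot (bigID (mem (supp y :\: supp u))) /= [X in _ + X]big1 ?addr0.
  apply: eq_bigr => i; rewrite finset.in_setD => /andP[/hard_threshold_out ui _].
  by rewrite !mxE ui !subr0.
move=> i; rewrite finset.in_setD negb_and negbK !mxE => /orP[/hard_threshold_in ->|].
  by rewrite subrr mul0r.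
rewrite inE negbK => /eqP ->.
have [/hard_threshold_in ->|/hard_threshold_out ->] := boolP (i \in supp u).
  by rewrite subrr mul0r.
by rewrite subrr mulr0.
Qed.

(** Hard thresholding is nearly a projection onto a convex set, in that the
    defect in the obtuse-angle criterion is small when [s] is large compared with
    the sparsity [k] of [y].  The [A] coordinates of [y] missed by the
    thresholding are outnumbered by the [B] selected coordinates outside the
    support of [y], in the proportion [#|A| <= rho^2 #|B|].  Each missed entry of
    [z] is dominated by each selected one, so the energy of [z] on [A] is at most
    [rho^2] times that on [B]; weighted AM-GM concludes. *)
Lemma hard_threshold_concavity (k : nat) (rho : R) (y : 'rV[R]_d) :
  0 < rho <= 1 -> k%:R <= rho ^+ 2 * s%:R -> sparse k y ->
  2 * dot (z - u) (y - u) <= rho * norm2 (u - y) ^+ 2.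
Proof.
move=> /andP[rho0 rho1] ks yk; rewrite dot_hard_threshold_residual.
pose A := supp y :\: S; pose B := S :\: supp y.
have [us|us] := ltnP #|S| s.
  rewrite big1 ?mulr0 => [|i]; first by rewrite mulr_ge0 ?sqr_ge0 // ltW.
  rewrite finset.in_setD => /andP[iS _].
  by rewrite (hard_threshold_unsaturated us iS) mul0r.
have AB : #|A|%:R <= rho ^+ 2 * #|B|%:R :> R.
  have cA : #|A|%:R + #|supp y :&: S|%:R = #|supp y|%:R :> R.
    by rewrite -natrD addnC cardsID.
  have cB : #|B|%:R + #|supp y :&: S|%:R = s%:R :> R.
    rewrite -natrD addnC finset.setIC cardsID; congr (_%:R); apply/eqP.
    by rewrite eqn_leq us hard_threshold_sparse.
  have yk' : #|supp y|%:R <= k%:R :> R by rewrite ler_nat.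
  have r1 : rho ^+ 2 <= 1 by rewrite expr_le1 // ltW.
  have : (1 - rho ^+ 2) * #|supp y :&: S|%:R >= 0.
    by rewrite mulr_ge0 ?subr_ge0.
  rewrite -cB in ks; rewrite -cA in yk'; lra.
(* Double counting over A x B, by the exchange inequality. *)
have zAB : \sum_(i in A) z ord0 i ^+ 2 <= rho ^+ 2 * \sum_(j in B) z ord0 j ^+ 2.
  have dbl : #|B|%:R * \sum_(i in A) z ord0 i ^+ 2
      <= #|A|%:R * \sum_(j in B) z ord0 j ^+ 2.
    rewrite mulr_sumr -[leRHS]sum_mem_card; apply: ler_sum => i.
    rewrite finset.in_setD => /andP[iS _]; rewrite -sum_mem_card; apply: ler_sum => j.
    by rewrite finset.in_setD => /andP[_ jS]; exact: hard_threshold_exchange.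
  have zB0 : 0 <= \sum_(j in B) z ord0 j ^+ 2.
    by apply: sumr_ge0 => j _; exact: sqr_ge0.
  have [B0|Bpos] := posnP #|B|.
    have A0 : A = finset.set0.
      apply/eqP; rewrite -cards_eq0 -leqn0 -(ler_nat R).
      by move: AB; rewrite B0 mulr0.
    by rewrite A0 big_set0 mulr_ge0 ?sqr_ge0.
  rewrite -(ler_pM2l (_ : 0 < #|B|%:R)) ?ltr0n //.
  apply: le_trans dbl _; rewrite mulrA [_%:R * _ ^+ 2]mulrC.
  exact: ler_wpM2r.
(* On [A] the vector [u] vanishes, on [B] the vector [y] does and [u = z]. *)
have split_le : \sum_(i in A) y ord0 i ^+ 2 + \sum_(j in B) z ord0 j ^+ 2
    <= norm2 (u - y) ^+ 2.
  rewrite norm2_sqr [leRHS](bigID (mem A)) /=; apply: lerD.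
    apply: ler_sum => i; rewrite finset.in_setD => /andP[/hard_threshold_out ui _].
    by rewrite !mxE ui sub0r sqrrN.
  rewrite [leRHS](bigID (mem B)) /= -[X in X <= _]addr0; apply: lerD; last first.
    by apply: sumr_ge0 => i _; exact: sqr_ge0.
  rewrite le_eqVlt; apply/orP; left; apply/eqP.
  apply: eq_big => [i|i].
    by rewrite !finset.in_setD; case: (i \in S); rewrite ?andbF.
  rewrite finset.in_setD => /andP[iy /hard_threshold_in ui].
  by move: iy; rewrite inE negbK => /eqP yi; rewrite !mxE ui yi subr0.
apply: le_trans (ler_wpM2l (ltW rho0) split_le); rewrite mulrDr.
have amgm : 2 * \sum_(i in A) z ord0 i * y ord0 i
    <= rho * \sum_(i in A) y ord0 i ^+ 2 + rho^-1 * \sum_(i in A) z ord0 i ^+ 2.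
  rewrite !mulr_sumr -big_split /=; apply: ler_sum => i _.
  rewrite -subr_ge0.
  suff -> : rho * y ord0 i ^+ 2 + rho^-1 * z ord0 i ^+ 2
      - 2 * (z ord0 i * y ord0 i)
      = rho^-1 * (rho * y ord0 i - z ord0 i) ^+ 2.
    by rewrite mulr_ge0 ?sqr_ge0 // invr_ge0 ltW.
  by field; rewrite gt_eqF.
apply: le_trans amgm _; rewrite lerD2l mulrC ler_pdivrMr //.
by rewrite mulrAC -expr2.
Qed.

End HardThresholding.

(** * One step of the iteration *)

Lemma abs_min_le (R : realType) (d : nat) (x : 'rV[R]_d) (a : R) (i : 'I_d) :
  (a%:E <= abs_min x)%E -> i \in supp x -> a <= `|x ord0 i|.
Proof.
move=> ax ix; rewrite -lee_fin; apply: le_trans ax _.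
exact: (@bigmin_le_cond _ _ _ _ _ _ (fun i => (`|x ord0 i|)%:E)).
Qed.

(** A coordinate of the support of [y] missing from that of [x] would alone
    contribute at least [a] to the distance. *)
Lemma supp_sub_of_dist (R : realType) (d : nat) (x y : 'rV[R]_d) (a : R) :
  (a%:E <= abs_min y)%E -> norm2 (x - y) ^+ 2 < a ^+ 2 -> 0 <= a ->
  supp y \subset supp x.
Proof.
move=> ay xy a0; apply/fintype.subsetP => i iy; rewrite inE; apply/eqP => xi.
have := abs_min_le ay iy; rewrite leNgt => /negP; apply.
rewrite -ltr_sqr ?nnegrE // real_normK ?num_real //.
apply: le_lt_trans xy; apply: le_trans (coord_sqr_le_norm2 _ i).
by rewrite !mxE xi sub0r sqrrN.
Qed.

Section PolyakStep.
Variables (R : realType) (d s : nat) (f : 'rV[R]_d -> R) (x y : 'rV[R]_d).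
Let g := grad f x.
Let h := norm2 (hard_threshold s g) ^+ 2.
Let gamma := polyak_step f (f y) s x.
Let z := x - gamma *: g.
Let xnext := hard_threshold s z.

Lemma polyak_step_ge0 : 0 <= gamma.
Proof.
apply: divr_ge0; first by rewrite le_max lexx orbT.
by apply: mulr_ge0 => //; exact: sqr_ge0.
Qed.

(** The constant 5 in the step size leaves room for the factor 2 coming from the
    two supports [supp x] and [supp xnext].  If the gradient vanishes, or if
    [f x <= f y], then [gamma] or [h] is zero. *)
Lemma polyak_step_energy :
  gamma * (2 * gamma * h) <= 2 * gamma * (f x - f y).
Proof.
have h0 : 0 <= h by exact: sqr_ge0.
have g0 := polyak_step_ge0.
have [fxy|fxy] := lerP (f x - f y) 0.
  suff -> : gamma = 0 by rewrite mul0r mulr0 mul0r.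
  by rewrite /gamma /polyak_step max_r // mul0r.
have [h00|hN0] := eqVneq h 0.
  by rewrite h00 !mulr0; apply: mulr_ge0; [apply: mulr_ge0|exact: ltW].
have gE : gamma * h = (f x - f y) / 5.
  rewrite /gamma /polyak_step max_l ?ltW // -/g -/h; field; exact: hN0.
have := mulr_ge0 g0 (ltW fxy).
rewrite -mulrA gE; nra.
Qed.

(** If the thresholding error is at most a fraction [c] of the new squared
    distance, one step inflates the squared distance by at most [1 / (1 - c)], for [c < 1]. *)
Lemma polyak_step_dist (c : R) :
  sparse s x -> dot g (y - x) <= f y - f x ->
  2 * dot (z - xnext) (y - xnext) <= c * norm2 (xnext - y) ^+ 2 ->
  (1 - c) * norm2 (xnext - y) ^+ 2 <= norm2 (x - y) ^+ 2.
Proof.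
move=> xs conv proj.
have g0 := polyak_step_ge0.
have expand : norm2 (xnext - y) ^+ 2 - 2 * dot (z - xnext) (y - xnext)
    = norm2 (x - y) ^+ 2 + 2 * gamma * dot g (y - x)
      + \sum_i (2 * gamma * g ord0 i * (x - xnext) ord0 i
                - (x - xnext) ord0 i ^+ 2).
  rewrite !norm2_sqr /dot !mulr_sumr -sumrB -!big_split /=.
  by apply: eq_bigr => i _; rewrite !mxE; ring.
have move_le : \sum_i (2 * gamma * g ord0 i * (x - xnext) ord0 i
                - (x - xnext) ord0 i ^+ 2) <= gamma * (2 * gamma * h).
  have -> : gamma * (2 * gamma * h) = gamma ^+ 2 * h + gamma ^+ 2 * h by ring.
  (* Completing the square coordinatewise: outside both supports the term is 0,
     elsewhere it is at most gamma^2 g_i^2. *)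
  have mass (T : {set 'I_d}) : (#|T| <= s)%N ->
      \sum_i gamma ^+ 2 * (if i \in T then g ord0 i ^+ 2 else 0)
        <= gamma ^+ 2 * h.
    move=> Ts; rewrite -mulr_sumr -big_mkcond; apply: ler_wpM2l.
      exact: sqr_ge0.
    exact: hard_threshold_mass.
  apply: le_trans (lerD (mass _ xs) (mass _ (@hard_threshold_sparse _ _ s z))).
  rewrite -big_split /=; apply: ler_sum => i _.
  have sq := sqr_ge0 (gamma * g ord0 i - (x - xnext) ord0 i).
  have gg : 0 <= gamma ^+ 2 * g ord0 i ^+ 2 by rewrite mulr_ge0 ?sqr_ge0.
  case: ifPn => ix; case: ifPn => iu; try lra.
  move: ix (hard_threshold_out iu); rewrite inE negbK !mxE => /eqP -> ->.
  by rewrite !subrr mulr0 expr0n mulr0 addr0 subrr.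
have := polyak_step_energy; have := ler_wpM2l g0 conv; lra.
Qed.

End PolyakStep.

(** * Staying in the noise ball *)

Theorem corollary1 (R : realType) (d : nat) (f : 'rV[R]_d -> R)
    (mu L tau : R) (mu_gt0 : 0 < mu) (L_gt0 : 0 < L) (tau_ge0 : 0 <= tau)
    (f_diff : forall x, differentiable f x)
    (f_rsc : restricted_strongly_convex f mu tau)
    (f_rs : restricted_smooth f L tau)
    (s sstar : nat) (sstar_gt0 : (0 < sstar)%N) (sstar_le_s : (sstar <= s)%N)
    (Lbar mubar kappabar : R)
    (LbarE : Lbar = L + 3 * tau * s%:R)
    (mubarE : mubar = mu - 3 * tau * s%:R)
    (kappabarE : kappabar = Lbar / mubar)
    (mubar_gt0 : 0 < mubar)
    (s_large : (240 * kappabar) ^+ 2 * sstar%:R <= s%:R)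
    (fmin fhat : R) (fminE : sparse_min f sstar fmin) (fmin_le : fmin <= fhat)
    (thetahat : 'rV[R]_d) (thetahat_sparse : sparse sstar thetahat)
    (f_thetahat : f thetahat = fhat)
    (theta0 : 'rV[R]_d) (theta0_sparse : sparse s theta0)
    (theta : nat -> 'rV[R]_d)
    (thetaE : forall t, theta t = sparse_polyak f fhat s theta0 t)
    (t0 : nat)
    (t0_hit : norm2 (theta t0 - thetahat) ^+ 2 <
      36 * norm2 (hard_threshold s (grad f thetahat)) ^+ 2 / mubar ^+ 2)
    (t0_first : forall t, (t < t0)%N ->
      ~ norm2 (theta t - thetahat) ^+ 2 <
        36 * norm2 (hard_threshold s (grad f thetahat)) ^+ 2 / mubar ^+ 2)
    (snr : ((7 * norm2 (hard_threshold s (grad f thetahat)) / mubar)%:E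
            <= abs_min thetahat)%E) :
  [/\ forall t, (t0 <= t)%N -> supp thetahat \subset supp (theta t),
      forall t t', (t0 <= t)%N -> (t <= t')%N ->
        norm2 (theta t' - thetahat) ^+ 2 <= norm2 (theta t - thetahat) ^+ 2
    & forall t, (t0 <= t)%N ->
        norm2 (theta t - thetahat) ^+ 2 <=
          36 * norm2 (hard_threshold s (grad f thetahat)) ^+ 2 / mubar ^+ 2].
Proof.
set g := norm2 (hard_threshold s (grad f thetahat)) in t0_hit t0_first snr *.
set b := 36 * g ^+ 2 / mubar ^+ 2 in t0_hit t0_first *.
have g_ge0 : 0 <= g by exact: norm2_ge0.
have b_gt0 : 0 < b by apply: le_lt_trans t0_hit; exact: sqr_ge0.
have g_neq0 : g != 0.
  by apply/eqP => g0; move: b_gt0; rewrite /b g0 expr0n mulr0 mul0r ltxx.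
have s_ge0 : 0 <= s%:R :> R by exact: ler0n.
have ts_ge0 : 0 <= tau * s%:R by exact: mulr_ge0.
have kappa_ge1 : 1 <= kappabar.
  have := restricted_convexity_le_smoothness tau_ge0 f_rsc f_rs
    (@hard_threshold_sparse _ _ s (grad f thetahat)) g_neq0.
  rewrite kappabarE ler_pdivlMr // mul1r; lra.
(* 13/49 = 1 - (6/7)^2 is the largest inflation parameter that keeps the next
   iterate within the radius of the signal-to-noise condition. *)
have [rho [rho_gt0 rho_le s_big]] : exists rho : R,
    [/\ 0 < rho, rho <= 13 / 49 & sstar%:R <= rho ^+ 2 * s%:R].
  have N_gt0 : 0 < 240 :> R by rewrite ltr0n.
  exists 240^-1; split; [by rewrite invr_gt0|by lra|].
  move: s_large N_gt0; move: (240 : R) => N s_large N_gt0.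
  rewrite exprVn mulrC ler_pdivlMr ?exprn_gt0 // mulrC.
  apply: le_trans s_large; rewrite ler_wpM2r // exprMn ler_peMr ?sqr_ge0 //.
  exact: exprn_ege1.
have rad : 0 <= 7 * g / mubar by rewrite divr_ge0 ?mulr_ge0 // ltW.
have bE : (7 * g / mubar) ^+ 2 = 49 / 36 * b by rewrite /b; field; rewrite gt_eqF.
have theta_sparse t : sparse s (theta t).
  rewrite thetaE; case: t => [//|t]; exact: hard_threshold_sparse.
have step t : norm2 (theta t - thetahat) ^+ 2 < b ->
    norm2 (theta t.+1 - thetahat) ^+ 2 <= norm2 (theta t - thetahat) ^+ 2.
  have -> : theta t.+1 = hard_threshold s
      (theta t - polyak_step f (f thetahat) s (theta t) *: grad f (theta t)).
    by rewrite f_thetahat !thetaE.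
  move: (theta t) (theta_sparse t) => x xs xb.
  have conv : dot (grad f x) (thetahat - x) <= f thetahat - f x.
    apply: (@sparse_gradient_ineq _ _ (s + s) _ mu tau) => //.
      rewrite natrD; lra.
    by apply: sparse_sub => //; exact: leq_trans sstar_le_s.
  (* The estimate is used with c = rho to locate the support of the next
     iterate, and then with c = 0. *)
  have dist c := @polyak_step_dist _ _ s f x thetahat c xs conv.
  move: dist; move: (x - _ *: _) => z dist.
  have sub : supp thetahat \subset supp (hard_threshold s z).
    have rho01 : 0 < rho <= 1 by rewrite rho_gt0; lra.
    have := dist rho (hard_threshold_concavity z rho01 s_big thetahat_sparse).
    have := ler_wpM2r (sqr_ge0 (norm2 (hard_threshold s z - thetahat))) rho_le.
    move=> le1 le2; apply: supp_sub_of_dist snr _ rad; rewrite bE; lra.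
  have := dist 0; rewrite subr0 mul1r mul0r; apply.
  rewrite dot_hard_threshold_residual.
  move: sub; rewrite -finset.setD_eq0 => /eqP ->.
  by rewrite big_set0 mulr0.
have inball t : (t0 <= t)%N -> norm2 (theta t - thetahat) ^+ 2 < b.
  elim: t => [|t IH].
    by rewrite leqn0 => /eqP t00; move: t0_hit; rewrite t00.
  rewrite leq_eqVlt => /orP[/eqP <- //|]; rewrite ltnS => /IH tb.
  exact: le_lt_trans (step _ tb) tb.
split.
- move=> t /inball tb; apply: supp_sub_of_dist snr _ rad; rewrite bE; lra.
- move=> t t' t0t; elim: t' => [|t' IH]; first by rewrite leqn0 => /eqP ->.
  rewrite leq_eqVlt => /orP[/eqP -> //|]; rewrite ltnS => tt'.
  apply: le_trans (IH tt'); apply: step; apply: inball; exact: leq_trans tt'.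
- by move=> t /inball /ltW.
Qed.
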